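(* The collection $\mathfrak{R}_\alpha$ satisfies Finite Quotient Permanence, for every ordinal $\alpha$. In particular, $\mathfrak{R}$ satisfies Finite Quotient Permanence.
   Context: A metric family is a set of metric spaces. A map of metric families $F\colon\mathcal{X}\to\mathcal{Y}$ is a collection of functions $f\colon X\to Y$ with $X\in\mathcal{X}$, $Y\in\mathcal{Y}$, such that each element of $\mathcal{X}$ is the domain of at least one function in $F$. $F$ is coarse if there is a non-decreasing function $\rho\colon[0,\infty)\to[0,\infty)$ with $d_Y(f(x),f(y))\le\rho(d_X(x,y))$ for all $f\colon X\to Y$ in $F$ and $x,y\in X$. A subfamily of $\mathcal{Y}$ is a metric family each of whose members is a subspace of some $Y\in\mathcal{Y}$; the inverse image of a subfamily $\mathcal{B}$ is $F^{-1}(\mathcal{B})=\{f^{-1}(B)\mid B\in\mathcal{B},\ f\in F\}$ (where $B$ is a subspace of the codomain of $f$). $\mathcal{X}$ is bounded if $\sup_{X\in\mathcal{X}}\operatorname{diam}X<\infty$. $\operatorname{asdim}(\mathcal{X})\le n$ means: for every $r>0$, each $X\in\mathcal{X}$ has a decomposition $X=X_0\cup\dots\cup X_n$ where each $X_i$ is a union of subspaces $X_{ij}$, $j\in J_i$, with $d(x,y)>r$ whenever $x\in X_{ij}$, $y\in X_{ij'}$, $j\ne j'$, such that the family of all $X_{ij}$ (over all $X$, $i$, $j$) is bounded. $\mathcal{X}$ has finite asymptotic dimension if $\operatorname{asdim}(\mathcal{X})\le n$ for some $n$. Let $\mathfrak{R}_0$ be the collection of bounded metric families. For an ordinal $\alpha>0$,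 $\mathcal{X}\in\mathfrak{R}_\alpha$ if there are a metric family $\mathcal{Y}$ with finite asymptotic dimension and a coarse map $F\colon\mathcal{X}\to\mathcal{Y}$ such that for every bounded subfamily $\mathcal{B}$ of $\mathcal{Y}$ there is an ordinal $\beta<\alpha$ with $F^{-1}(\mathcal{B})\in\mathfrak{R}_\beta$. $\mathfrak{R}$ is the collection of metric families lying in $\mathfrak{R}_\alpha$ for some countable ordinal $\alpha$ (those with regular finite decomposition complexity). If a finite group $F$ acts isometrically on a metric space $X$, the quotient $F\backslash X$ carries the metric $d(Fx,Fx')=\min_{h\in F}d_X(x,hx')$. A collection $\mathfrak{C}$ of metric families satisfies Finite Quotient Permanence if: whenever $\mathcal{X}\in\mathfrak{C}$ and $F$ is a finite group that acts isometrically on every $X\in\mathcal{X}$, the family $F\backslash\mathcal{X}:=\{F\backslash X\mid X\in\mathcal{X}\}$ is also in $\mathfrak{C}$. *)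

(* Defs.v *)
From HB Require Import structures.
From mathcomp Require Import all_boot all_order all_algebra all_fingroup.
From mathcomp Require Import generic_quotient.
From mathcomp Require Import boolp classical_sets cardinality wochoice.
From mathcomp Require Import reals constructive_ereal ereal.
From mathcomp Require Import topology.

Set Implicit Arguments.
Unset Strict Implicit.
Unset Printing Implicit Defensive.

Import Order.TTheory GRing.Theory Num.Theory.

Local Open Scope classical_set_scope.
Local Open Scope ring_scope.

(** * Subspaces of a metric space *)

(* An alias of [set_type B], so that the metric structure below does not
   interfere with other structures on subset types. *)
Definition subsp (R : realType) (X : metricType R) (B : set X) : Type :=
  set_type B.

Section SubspaceMetric.
Variables (R : realType) (X : metricType R) (B : set X).

HB.instance Definition _ := Choice.on (subsp B).

Definition subsp_dist (x y : subsp B) : R := mdist (\val x) (\val y).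

Fact subsp_distxx x : subsp_dist x x = 0.
Proof. exact: mdistxx. Qed.

Fact subsp_dist_positivity x y : subsp_dist x y = 0 -> x = y.
Proof. by move=> /mdist_positivity /val_inj. Qed.

Fact subsp_dist_sym x y : subsp_dist x y = subsp_dist y x.
Proof. exact: metric_sym. Qed.

Fact subsp_dist_triangle y x z :
  subsp_dist x z <= subsp_dist x y + subsp_dist y z.
Proof. exact: metric_triangle. Qed.

HB.instance Definition _ := isMetric.Build R (subsp B)
  subsp_distxx subsp_dist_positivity subsp_dist_sym subsp_dist_triangle.

End SubspaceMetric.

(** * Quotients by isometric actions of finite groups *)

(* The actions of [action.v] are right actions; this is a left action. *)
Record isom_action (R : realType) (gT : finGroupType) (X : metricType R) :=
  IsomAction {
    isom_act :> gT -> X -> X;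
    isom_act1 : forall x : X, isom_act 1%g x = x;
    isom_actM : forall (h k : gT) (x : X),
      isom_act (h * k)%g x = isom_act h (isom_act k x);
    isom_act_isom : forall (h : gT) (x y : X),
      mdist (isom_act h x) (isom_act h y) = mdist x y
  }.

Section Quotient.
Variables (R : realType) (gT : finGroupType) (X : metricType R).
Variable to : isom_action gT X.

Definition same_orbit (x y : X) : bool := [exists h : gT, y == to h x].

Fact same_orbit_refl : reflexive same_orbit.
Proof. by move=> x; apply/existsP; exists 1%g; rewrite isom_act1. Qed.

Fact same_orbit_sym : symmetric same_orbit.
Proof.
suff H x y : same_orbit x y -> same_orbit y x.
  by move=> x y; apply/idP/idP => /H.
move=> /existsP[h /eqP->]; apply/existsP; exists h^-1%g.
by rewrite -isom_actM mulVg isom_act1.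
Qed.

Fact same_orbit_trans : transitive same_orbit.
Proof.
move=> y x z /existsP[h /eqP->] /existsP[k /eqP->]; apply/existsP.
by exists (k * h)%g; rewrite isom_actM.
Qed.

Canonical same_orbit_equiv :=
  EquivRel same_orbit same_orbit_refl same_orbit_sym same_orbit_trans.

Definition quot : Type := {eq_quot same_orbit}%qT.

HB.instance Definition _ := Choice.on quot.
HB.instance Definition _ := EqQuotient.on quot.

Definition orbit_dist (x y : X) : R :=
  \big[Order.min/mdist x y]_(h : gT) mdist x (to h y).

Definition quot_dist (p q : quot) : R := orbit_dist (repr p) (repr q).

Lemma orbit_dist_le (x y : X) (h : gT) : orbit_dist x y <= mdist x (to h y).
Proof. exact: bigmin_le. Qed.

Lemma orbit_dist_attained (x y : X) :
  exists h : gT, orbit_dist x y = mdist x (to h y).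
Proof.
rewrite /orbit_dist; elim/big_ind: _ => [|_ _ [h ->] [k ->]|h _].
- by exists 1%g; rewrite isom_act1.
- by rewrite /Order.min; case: ifP => _; [exists h|exists k].
- by exists h.
Qed.

Lemma quot_distE (x y : X) :
  quot_dist (\pi_quot x)%qT (\pi_quot y)%qT = orbit_dist x y.
Proof.
have orb z : exists h : gT, repr (\pi_quot z)%qT = to h z.
  have /eqquotP : (z = repr (\pi_quot z) %[mod quot])%qT by rewrite reprK.
  by move=> /existsP[h /eqP]; exists h.
have [h xh] := orb x; have [k yk] := orb y.
rewrite /quot_dist xh yk; apply/eqP; rewrite eq_le; apply/andP; split.
- have [l ->] := orbit_dist_attained x y.
  apply: le_trans (orbit_dist_le _ _ (h * l * k^-1)%g) _.
  by rewrite -isom_actM mulgKV isom_actM isom_act_isom.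
- have [l ->] := orbit_dist_attained (to h x) (to k y).
  apply: le_trans (orbit_dist_le _ _ (h^-1 * l * k)%g) _.
  by rewrite -(isom_act_isom to h) -!isom_actM !mulgA mulgV mul1g.
Qed.

Fact quot_distxx p : quot_dist p p = 0.
Proof.
apply/eqP; rewrite eq_le; apply/andP; split.
  by apply: le_trans (orbit_dist_le _ _ 1%g) _; rewrite isom_act1 mdistxx.
by rewrite /quot_dist; have [h ->] := orbit_dist_attained (repr p) (repr p);
  exact: mdist_ge0.
Qed.

Fact quot_dist_positivity p q : quot_dist p q = 0 -> p = q.
Proof.
rewrite /quot_dist; have [h ->] := orbit_dist_attained (repr p) (repr q).
move=> /mdist_positivity e; rewrite -[p]reprK -[q]reprK.
apply/eqquotP; rewrite /= same_orbit_sym; apply/existsP; exists h.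
by rewrite e.
Qed.

Fact quot_dist_sym p q : quot_dist p q = quot_dist q p.
Proof.
suff H r s : quot_dist r s <= quot_dist s r by apply/eqP; rewrite eq_le !H.
rewrite /quot_dist; have [h ->] := orbit_dist_attained (repr s) (repr r).
apply: le_trans (orbit_dist_le _ _ h^-1%g) _.
by rewrite -(isom_act_isom to h) -isom_actM mulgV isom_act1 metric_sym.
Qed.

Fact quot_dist_triangle q p r : quot_dist p r <= quot_dist p q + quot_dist q r.
Proof.
rewrite /quot_dist; have [h ->] := orbit_dist_attained (repr p) (repr q).
have [k ->] := orbit_dist_attained (repr q) (repr r).
apply: le_trans (orbit_dist_le _ _ (h * k)%g) _.
apply: le_trans (metric_triangle _ (to h (repr q)) _) _.
by rewrite lerD2l isom_actM isom_act_isom.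
Qed.

HB.instance Definition _ := isMetric.Build R quot
  quot_distxx quot_dist_positivity quot_dist_sym quot_dist_triangle.

End Quotient.

(** * Metric families *)

Definition mfamily (R : realType) := metricType R -> Prop.

Section Families.
Variable R : realType.
Implicit Types XX YY : mfamily R.

Definition diam (X : metricType R) : \bar R :=
  ereal_sup [set (mdist x y)%:E | x in [set: X] & y in [set: X]].

Definition bounded_family XX : Prop :=
  (ereal_sup [set d | exists2 X : metricType R, XX X & d = diam X] < +oo)%E.

Definition fam_fun := forall X Y : metricType R, (X -> Y) -> Prop.

Definition is_family_map (F : fam_fun) XX YY : Prop :=
  (forall (X Y : metricType R) (f : X -> Y), F X Y f -> XX X /\ YY Y) /\
  (forall X : metricType R, XX X ->
     exists (Y : metricType R) (f : X -> Y), F X Y f).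

Definition coarse (F : fam_fun) : Prop :=
  exists rho : R -> R,
    [/\ forall t, 0 <= t -> 0 <= rho t,
        forall s t, 0 <= s -> s <= t -> rho s <= rho t
      & forall (X Y : metricType R) (f : X -> Y), F X Y f ->
          forall x y, mdist (f x) (f y) <= rho (mdist x y)].

(* A collection of subspaces records, with each subset [B], the ambient space
   [Y] of which [B] is a subset. *)
Definition subspaces := forall Y : metricType R, set Y -> Prop.

Definition is_subfamily (BB : subspaces) YY : Prop :=
  forall (Y : metricType R) (B : set Y), BB Y B -> YY Y.

Definition family_of (BB : subspaces) : mfamily R := fun Z =>
  exists (Y : metricType R) (B : set Y), BB Y B /\ Z = subsp B :> metricType R.

Definition inv_image (F : fam_fun) (BB : subspaces) : subspaces := fun X A =>
  exists (Y : metricType R) (f : X -> Y) (B : set Y),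
    [/\ F X Y f, BB Y B & A = f @^-1` B].

Definition asdim_le (n : nat) XX : Prop := forall r : R, 0 < r ->
  exists (J : metricType R -> 'I_n.+1 -> Type)
         (U : forall (X : metricType R) (i : 'I_n.+1), J X i -> set X),
    [/\ forall X : metricType R, XX X ->
          [set: X] = \bigcup_i \bigcup_j U X i j,
        forall X : metricType R, XX X ->
          forall i (j j' : J X i), j <> j' ->
          forall x y, U X i j x -> U X i j' y -> r < mdist x y
      & bounded_family (family_of (fun X A =>
          XX X /\ exists i j, A = U X i j))].

Definition finite_asdim XX : Prop := exists n, asdim_le n XX.

End Families.

(** * Ordinals *)

(* An ordinal is presented by a well-ordered set of that order type; isomorphic
   well-ordered sets present the same ordinal. *)
Record ord := Ord {
  ord_sort :> Type;
  ord_le : rel ord_sort;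
  ord_wo : well_order ord_le
}.

Definition is_ord0 (a : ord) : Prop := a -> False.

(* [b < a]: [b] is isomorphic to a proper initial segment of [a] *)
Definition ord_lt (b a : ord) : Prop :=
  exists (x : a) (f : b -> a),
    (forall y z : b, ord_le (f y) (f z) = ord_le y z) /\
    range f = [set y | ord_le y x /\ y <> x].

Definition countable_ord (a : ord) : Prop := countable [set: a].

(** * Regular finite decomposition complexity *)

Inductive frakR (R : realType) : ord -> mfamily R -> Prop :=
| frakR_bounded (a : ord) (XX : mfamily R) :
    is_ord0 a -> bounded_family XX -> frakR a XX
| frakR_step (a : ord) (XX YY : mfamily R) (F : fam_fun R) :
    ~ is_ord0 a -> finite_asdim YY -> is_family_map F XX YY -> coarse F ->
    (forall BB : subspaces R,
        is_subfamily BB YY -> bounded_family (family_of BB) ->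
        exists b : ord, ord_lt b a /\ frakR b (family_of (inv_image F BB))) ->
    frakR a XX.

Definition regular_fdc (R : realType) (XX : mfamily R) : Prop :=
  exists a : ord, countable_ord a /\ frakR a XX.

(** * Finite Quotient Permanence *)

Definition quot_family (R : realType) (gT : finGroupType) (XX : mfamily R)
    (to : forall X : metricType R, XX X -> isom_action gT X) : mfamily R :=
  fun Z => exists (X : metricType R) (hX : XX X),
    Z = quot (to X hX) :> metricType R.

Definition finite_quotient_permanence (R : realType)
    (CC : mfamily R -> Prop) : Prop :=
  forall XX : mfamily R, CC XX ->
  forall (gT : finGroupType)
    (to : forall X : metricType R, XX X -> isom_action gT X),
  CC (quot_family to).

(* Main.v *)
From HB Require Import structures.
Require Import Defs.
From mathcomp Require Import all_boot all_order all_algebra all_fingroup.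
From mathcomp Require Import generic_quotient.
From mathcomp Require Import boolp classical_sets.
From mathcomp Require Import reals constructive_ereal ereal topology.
From mathcomp Require Import zify.

Set Implicit Arguments.
Unset Strict Implicit.
Unset Printing Implicit Defensive.

Import Order.TTheory GRing.Theory Num.Theory.

Local Open Scope classical_set_scope.

(** The step of the definition of [frakR] replaces a metric by a coarser one
of finite asymptotic dimension whose bounded sets are simpler. So, given a
coarse map [f] from [X] to a space [Y] of finite asymptotic dimension and a
finite group acting on [X], the task is to find a coarser metric of finite
asymptotic dimension on the quotient. Its bounded sets must be controlled by
bounded sets of [Y], and the difficulty is that the preimage in [X] of a small
piece of the quotient is a union of translates of one piece of [X], which lie
at arbitrary distances from each other and are unrelated in [Y]. The induction
therefore proves a more flexible statement ([frakR_sheeted]): a space [Z] is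
controlled by [X] as soon as its points can be represented by boundedly many
points of a space [W], in such a way that distances in [Z] are Hausdorff
distances of these finite configurations, and that every configuration meets a
subset [A] of [W] which is roughly isometric to a subset of [X]. For the
quotient by a finite group the configurations are the orbits and [A] is
everything ([quot_sheeted]).

For the inductive step, a horoball is glued to [A] ([cone_off]): the distance
pulled back from [Y], which only makes sense on [A], is extended to all of [W]
by sending a point to a nearest point of [A] and letting distances in [Y]
count only beyond a scale comparable to the distance from [A]. This has finite
asymptotic dimension because far from [A] one may use the decompositions of
[Y] at larger and larger scales, provided that the scales of [Y] have been
renumbered so that a decomposition at scale [n] has pieces of size [n + 1]
([regraded_pullback], [horo_colouring]). A set bounded in the horoball and
containing a point of [A] stays close to [A], so that it is again roughly
isometric to a subset of [X], and that subset has bounded image in [Y]. Hence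
a set of configurations which is bounded for the Hausdorff distance of the
horoball is again of the kind treated by the induction: fix one configuration
and a point of it in [A]; every other configuration has a point nearby.

It remains that finite asymptotic dimension passes from a space to its
configurations of boundedly many points ([haus_colouring]). All estimates are
made with integer distances up to additive errors, and decompositions are
encoded by colourings. *)

(** * Quasi-metrics and colourings *)

Definition least (P : nat -> Prop) : nat :=
  if pselect (exists n, `[< P n >]) is left exP then ex_minn exP else 0.

Lemma least_leP (P : nat -> Prop) : (exists n, P n) ->
  {homo P : m n / m <= n >-> (m -> n : Prop)} ->
  forall n, (least P <= n <-> P n).
Proof.
move=> exP Pup n; rewrite /least; case: pselect => [ex|nex]; last first.
  by case: exP => m Pm; case: nex; exists m; apply/asboolP.
case: ex_minnP => m /asboolP Pm min; split=> [/Pup|Pn]; first exact.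
exact/min/asboolP.
Qed.

(** The error [1] is harmless: adding [1] to all distances between distinct
points makes the triangle inequality exact, see [gauged]. *)
Definition quasimetric (T : Type) (q : T -> T -> nat) : Prop :=
  [/\ forall x, q x x = 0, forall x y, q x y = q y x
    & forall y x z, q x z <= (q x y + q y z).+1].

(** The inequality satisfied by the logarithm of a metric. *)
Definition quasiultrametric (T : Type) (q : T -> T -> nat) : Prop :=
  [/\ forall x, q x x = 0, forall x y, q x y = q y x
    & forall y x z, q x z <= (maxn (q x y) (q y z)).+1].

(** A decomposition into colour classes, each of which splits into pieces of
diameter at most [D] with mutual distances greater than [r]. The relation [E]
stands for lying in the same piece; keeping it as an arbitrary transitive
relation spares the chains of [r]-close points that would generate it. *)
Definition colouring (T : Type) (K : finType) (q : T -> T -> nat) (r D : nat) :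
    Prop :=
  exists (c : T -> K) (E : T -> T -> Prop),
    [/\ forall y x z, E x y -> E y z -> E x z,
        forall x y, c x = c y -> q x y <= r -> E x y
      & forall x y, E x y -> q x y <= D].

(** * The horoball over a subset *)

(** With [q] a logarithmic distance, [horo] is, up to multiplicative and
additive constants, the distance between the points of base [u w] and height
[L w] in a combinatorial horoball, whose length scale doubles with each unit
of height. *)
Section Horoball.
Variables (T X : Type) (L : T -> nat) (u : T -> X) (q : X -> X -> nat).

Definition horo (w w' : T) : nat :=
  maxn (q (u w) (u w')) (maxn (L w) (L w')) - minn (L w) (L w').

(** For the triangle inequality, the difference between the two minima of
heights is absorbed by whichever of the two steps changes height. *)
Lemma horo_quasimetric : quasiultrametric q -> quasimetric horo.
Proof.
case=> q0 qC qM; split=> [x|x y|y x z]; rewrite /horo.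
- by rewrite q0; lia.
- by rewrite qC maxnC; lia.
- by have := qM (u y) (u x) (u z); lia.
Qed.

(** Heights are cut into bands of width [r + 1], coloured by their parity, so
that two close points of the same colour lie in the same band. Within a band
the horoball distance is [q] minus the height, up to the width of the band: a
decomposition for [q] at the scale of the band has pieces that are bounded
independently of the band. *)
Lemma horo_colouring (K : finType) (r : nat) :
  (forall s, colouring K q s s.+1) ->
  colouring (bool * K)%type horo r (2 * r).+2.
Proof.
move=> /choice[c] /choice[E] cE; pose b w := L w %/ r.+1.
pose s w := r + (b w).+1 * r.+1.
have bl w : b w * r.+1 <= L w by rewrite leq_trunc_div.
have bu w : L w < (b w).+1 * r.+1 by rewrite ltn_ceil.
exists (fun w => (odd (b w), c (s w) (u w))).
exists (fun w w' => b w = b w' /\ E (s w) (u w) (u w')); split.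
- move=> y x z [bxy Exy] [byz Eyz]; split; first by rewrite bxy.
  case: (cE (s x)) => tr _ _; apply: tr Exy _.
  by rewrite /s bxy.
- move=> x y [oxy cxy]; rewrite /horo => h.
  have bxy : b x = b y.
    have lx := bl x; have ux := bu x; have ly := bl y; have uy := bu y.
    (* Adjacent bands of the same parity coincide. *)
    have : b x <= (b y).+1 /\ b y <= (b x).+1.
      split; rewrite -ltnS -(ltn_pmul2r (ltn0Sn r)); lia.
    have := congr1 nat_of_bool oxy.
    by rewrite -!modn2; lia.
  split=> //; case: (cE (s x)) => _ cl _; apply: cl.
    by rewrite cxy /s bxy.
  have := bu x; rewrite /s; lia.
- move=> x y [bxy Exy]; case: (cE (s x)) => _ _ /(_ _ _ Exy).
  rewrite /horo /s; move: (bl x) (bu x) (bl y) (bu y); rewrite -bxy; lia.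
Qed.

End Horoball.

(** * The Hausdorff distance on finite configurations *)

Section Hausdorff.
Variables (Z W : Type) (I : finType) (s : I -> Z -> W) (h : W -> W -> nat).

Definition haus_near (n : nat) (z z' : Z) : Prop :=
  forall i, exists i', h (s i z) (s i' z') <= n.

Definition haus (z z' : Z) : nat :=
  least (fun n => haus_near n z z' /\ haus_near n z' z).

Hypothesis hq : quasimetric h.

Lemma haus_leP n z z' : haus z z' <= n <-> haus_near n z z' /\ haus_near n z' z.
Proof.
apply: (least_leP _ _ n) => [|m k mk [H1 H2]].
- exists (\max_i \max_i' maxn (h (s i z) (s i' z')) (h (s i z') (s i' z))).
  by split=> i; exists i; apply: leq_trans (leq_bigmax i);
     apply: leq_trans (leq_bigmax i); rewrite ?leq_maxl ?leq_maxr.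
- by split=> i; [have [i' H] := H1 i|have [i' H] := H2 i]; exists i';
     apply: leq_trans mk.
Qed.

Lemma haus_quasimetric : quasimetric haus.
Proof.
have [h0 hC hM] := hq.
have tri n m y x z : haus_near n x y -> haus_near m y z ->
    haus_near (n + m).+1 x z.
  move=> xy yz i; have [j xyj] := xy i; have [k yzk] := yz j; exists k.
  by apply: leq_trans (hM (s j y) _ _) _; rewrite ltnS leq_add.
split=> [x|x y|y x z].
- by apply/eqP; rewrite -leqn0; apply/haus_leP; split=> i; exists i; rewrite h0.
- suff H x' y' : haus x' y' <= haus y' x' by apply/eqP; rewrite eqn_leq !H.
  by apply/haus_leP; have /haus_leP[] := leqnn (haus y' x').
- have /haus_leP[xy yx] := leqnn (haus x y).
  have /haus_leP[yz zy] := leqnn (haus y z).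
  apply/haus_leP; split; first exact: tri xy yz.
  by rewrite addnC; exact: tri zy yx.
Qed.

Lemma stable_subset (S : finType) (A : nat -> {set S}) :
  (forall j, A j \subset A j.+1) -> exists j : 'I_#|S|.+1, A j = A j.+1.
Proof.
move=> Aup; apply: contrapT => ne.
have card j : j <= #|S|.+1 -> j <= #|A j|.
  elim: j => // j IH jS; apply: leq_ltn_trans (IH (ltnW jS)) _.
  apply: proper_card; rewrite finset.properEneq Aup andbT; apply/eqP => e.
  by apply: ne; exists (Ordinal jS).
by have := leq_trans (card _ (leqnn _)) (max_card _); rewrite ltnn.
Qed.

(** Let [N] be the number of pairs of an index and a colour. For [j <= N + 1]
look at the pairs [(i, k)] such that the colour [k] occurs within [j * (r +
1)] of [s i z]. These sets grow with [j], so that they are constant from some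
[j <= N] to [j + 1], and this [j] is the colour of [z]. When the large-scale
colouring of [W] is separated by more than all these radii, each such pair
determines a single piece; then [r]-close points [z] and [z'] of the same
colour [j] see exactly the same pieces within [j * (r + 1)], and seeing the
same pieces is a transitive relation that forces the configurations to be
close. *)
Lemma haus_colouring (K : finType) (r D : nat) :
  let N := #|{: I * K}| in
  colouring K h ((2 * N).+1 * r.+1).+1 D ->
  colouring 'I_N.+1 haus r (D + N * r.+1).+1.
Proof.
move=> N [c] [E] [Etr Ecl Ebd]; have [h0 hC hM] := hq.
pose near j z w := exists i, h (s i z) w <= j * r.+1.
pose A z j := [set p : I * K |
  `[< exists w, h (s p.1 z) w <= j * r.+1 /\ c w = p.2 >]]%SET.
have Aup z j : A z j \subset A z j.+1.
  apply/fintype.subsetP => p; rewrite !finset.inE => /asboolP[w [wz wp]].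
  apply/asboolP.
  by exists w; split=> //; apply: leq_trans wz _; rewrite leq_mul2r leqnSn orbT.
have [J JP] := choice (fun z => stable_subset (Aup z)).
pose link z z' :=
  forall w, near (J z) z w -> exists w', near (J z) z' w' /\ E w w'.
have linkP x y : J x = J y -> haus_near r x y -> link x y.
  move=> Jxy xy w [i iw]; have [k ik] := xy i.
  (* The radius grows by [r + 1] when passing from [x] to [y], and the choice of
  [J y] undoes this growth. *)
  have : (k, c w) \in A y (J y).+1.
    rewrite finset.inE; apply/asboolP; exists w; split=> //=.
    apply: leq_trans (hM (s i x) _ _) _.
    by rewrite hC -Jxy mulSn -addSn leq_add.
  rewrite -JP finset.inE => /asboolP[/= w' [kw' cw']].
  exists w'; split; first by exists k; rewrite Jxy.
  apply: Ecl => //; have JN : J x <= N by rewrite -ltnS.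
  have := leq_mul JN (leqnn r.+1); rewrite -Jxy in kw'.
  have := hM (s i x) w w'; have := hM (s k y) (s i x) w'.
  move: iw; rewrite [h (s i x) w]hC mulSn -mulnA.
  by move: (J x * r.+1) (N * r.+1) kw' ik => a b; lia.
have linkB x y : J x = J y -> link x y -> haus_near (D + N * r.+1).+1 x y.
  move=> Jxy xy i; have [|w [[k kw] Ew]] := xy (s i x).
    by exists i; rewrite h0.
  exists k; apply: leq_trans (hM w _ _) _; rewrite ltnS leq_add ?Ebd//.
  rewrite hC; apply: leq_trans kw _; rewrite leq_mul2r.
  by rewrite -[J x <= N]ltnS ltn_ord orbT.
exists J, (fun z z' => [/\ J z = J z', link z z' & link z' z]); split.
- have ltr y x z : J x = J y -> link x y -> link y z -> link x z.
    move=> Jxy xy yz w /xy[w' [w'y Ew]]; rewrite Jxy in w'y.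
    have [v [vz Ev]] := yz _ w'y; exists v; rewrite Jxy; split=> //.
    exact: Etr Ew Ev.
  move=> y x z [Jxy xy yx] [Jyz yz zy]; split; first by rewrite Jxy.
    exact: ltr xy yz.
  by apply: ltr zy yx.
- by move=> x y Jxy /haus_leP[xy yx]; split=> //; exact: linkP.
- by move=> x y [Jxy xy yx]; apply/haus_leP; split; exact: linkB.
Qed.

End Hausdorff.

(** * Integer distances in metric spaces *)

Definition upnat (R : realType) (t : R) : nat := least (fun n => t <= n%:R)%R.

Lemma upnat_le (R : realType) (t : R) n : (upnat t <= n) = (t <= n%:R)%R.
Proof.
have [|m k mk /le_trans->//|H1 H2] := @least_leP (fun n => t <= n%:R)%R _ _ n.
- exists (Num.bound `|t|%R); apply/ltW/(le_lt_trans (ler_norm t)).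
  exact/archi_boundP/normr_ge0.
- by rewrite ler_nat.
- exact/idP/idP.
Qed.

Definition nd (R : realType) (X : metricType R) (x y : X) : nat :=
  upnat (mdist x y).

Section NatDist.
Variables (R : realType) (X : metricType R).
Implicit Types x y z : X.

Lemma nd_le x y n : (nd x y <= n) = (mdist x y <= n%:R)%R.
Proof. exact: upnat_le. Qed.

Lemma ndxx x : nd x x = 0.
Proof. by apply/eqP; rewrite -leqn0 nd_le mdistxx. Qed.

Lemma ndC x y : nd x y = nd y x.
Proof. by rewrite /nd metric_sym. Qed.

Lemma nd_triangle y x z : nd x z <= nd x y + nd y z.
Proof.
rewrite nd_le natrD; apply: le_trans (metric_triangle x y z) _.
by rewrite lerD // -nd_le.
Qed.

End NatDist.

Section FamiliesNat.
Variable R : realType.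
Implicit Types XX YY : mfamily R.

Lemma bounded_familyP XX : bounded_family XX <->
  exists n, forall X : metricType R, XX X -> forall x y : X, nd x y <= n.
Proof.
split=> [bXX|[n nXX]].
  have [r rXX] : exists r : R, (ereal_sup
      [set d | exists2 X : metricType R, XX X & d = diam X] <= r%:E)%E.
    move: bXX; rewrite /bounded_family; case: (ereal_sup _) => [r _||_] //.
      by exists r.
    by exists 0%R; rewrite leNye.
  exists (upnat r) => X hX x y; rewrite nd_le -lee_fin.
  apply: (@le_trans _ _ r%:E); last by rewrite lee_fin -upnat_le.
  apply: le_trans rXX; apply: le_trans (ereal_sup_ubound _); last first.
    by exists X.
  by apply: ereal_sup_ubound => /=; exists x => //; exists y.
apply: (@le_lt_trans _ _ n%:R%:E); last exact: ltry.
apply/ereal_supP => _ [X hX ->]; apply/ereal_supP => _ [x _ [y _ <-]].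
by rewrite lee_fin -nd_le nXX.
Qed.

Lemma nd_subsp (X : metricType R) (B : set X) (x y : subsp B) :
  nd x y = nd (\val x) (\val y).
Proof. by []. Qed.

Lemma bounded_family_ofP (BB : subspaces R) : bounded_family (family_of BB) <->
  exists n, forall (Y : metricType R) (B : set Y), BB Y B ->
    forall x y, B x -> B y -> nd x y <= n.
Proof.
split=> [/bounded_familyP[n H]|[n H]].
  exists n => Y B hB x y Bx By.
  have /(H _) : family_of BB (subsp B) by exists Y, B.
  by move=> /(_ (SigSub (mem_set Bx)) (SigSub (mem_set By))).
apply/bounded_familyP; exists n => _ [Y [B [hB ->]]] x y.
by rewrite nd_subsp (H _ _ hB)//; exact: set_valP.
Qed.

Lemma coarseP (F : fam_fun R) : coarse F <->
  exists rho : nat -> nat, forall (X Y : metricType R) (f : X -> Y), F X Y f ->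
    forall x y, nd (f x) (f y) <= rho (nd x y).
Proof.
split=> [[rho [rho0 rho_nd rhoF]]|[rho rhoF]].
  exists (fun n => upnat (rho n%:R%R)) => X Y f Ff x y; rewrite nd_le.
  apply: (le_trans (rhoF _ _ _ Ff _ _)).
  apply: (@le_trans _ _ (rho (nd x y)%:R%R)).
    by apply: rho_nd; rewrite ?mdist_ge0// -nd_le.
  by rewrite -upnat_le.
exists (fun t => (\max_(k < (upnat t).+1) rho k)%:R)%R.
split=> [t t0|a b a0 ab|X Y f Ff x y]; first exact: ler0n.
- rewrite ler_nat; apply/bigmax_leqP => k _.
  have kb : k < (upnat b).+1.
    rewrite (leq_trans (ltn_ord k))// ltnS upnat_le (le_trans ab)//.
    by rewrite -upnat_le.
  exact: (leq_bigmax (Ordinal kb)).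
- rewrite -nd_le; apply: leq_trans (rhoF _ _ _ Ff _ _) _.
  exact: (leq_bigmax (@ord_max (nd x y))).
Qed.

(** The pieces are the classes of the symmetrized relation within one colour. *)
Lemma colouring_decomposition (X : metricType R) (K : finType) r D :
  colouring K (@nd R X) r D ->
  exists U : 'I_#|K|.+1 -> set (set X),
    [/\ forall x, exists i S, U i S /\ S x,
        forall i S S', U i S -> U i S' -> S <> S' ->
          forall x y, S x -> S' y -> r < nd x y
      & forall i S, U i S -> forall x y, S x -> S y -> nd x y <= D].
Proof.
move=> [c] [E] [Etr Ecl Ebd].
pose col y : 'I_#|K|.+1 := inord (enum_rank (c y)).
have colI x y : col x = col y -> c x = c y.
  move=> /(congr1 val); rewrite /= !inordK ?(leq_trans (ltn_ord _))//.
  by move=> /val_inj/enum_rank_inj.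
pose cls y := [set x | [/\ c x = c y, E y x & E x y]].
exists (fun i S => exists y, i = col y /\ S = cls y); split.
- by move=> x; exists (col x), (cls x); split; [exists x|split=> //; apply: Ecl;
    rewrite ?ndxx].
- move=> i _ _ [y [-> ->]] [y' [/colI cyy' ->]] ne x x' [cx Eyx Exy].
  move=> [cx' Eyx' Ex'y']; rewrite ltnNge; apply/negP => xx'; apply: ne.
  have Exx' : E x x' by apply: Ecl; rewrite // cx cx'.
  have Ex'x : E x' x by apply: Ecl; rewrite ?cx ?cx' // ndC.
  have Eyy' : E y y' by exact: (Etr _ _ _ (Etr _ _ _ Eyx Exx') Ex'y').
  have Ey'y : E y' y by exact: (Etr _ _ _ (Etr _ _ _ Eyx' Ex'x) Exy).
  rewrite /cls cyy'; apply/seteqP; split=> z [cz Eyz Ezy]; split=> //.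
  + exact: (Etr _ _ _ Ey'y Eyz).
  + exact: (Etr _ _ _ Ezy Eyy').
  + exact: (Etr _ _ _ Eyy' Eyz).
  + exact: (Etr _ _ _ Ezy Ey'y).
- move=> _ _ [y [_ ->]] x x' [_ _ Exy] [_ Eyx' _].
  exact: (Ebd _ _ (Etr _ _ _ Exy Eyx')).
Qed.

Lemma finite_asdimP YY : finite_asdim YY <->
  exists K : finType, forall r, exists D, forall Y : metricType R, YY Y ->
    colouring K (@nd R Y) r D.
Proof.
split=> [[n YYn]|[K YYK]].
  exists 'I_n.+1 => r; have [|J [U [cov sep /bounded_family_ofP[D bnd]]]] :=
    YYn r.+1%:R%R; first by rewrite ltr0n.
  exists D => Y hY.
  have /choice[c cP] (y : Y) : exists i, exists j, U Y i j y.
    have : [set: Y] y by [].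
    by rewrite (cov _ hY) => -[i _ [j _ Uy]]; exists i, j.
  have same i (j j' : J Y i) x y : U Y i j x -> U Y i j' y -> nd x y <= r ->
      j = j'.
    move=> Ux Uy; rewrite nd_le => xy; apply: contrapT => ne.
    have := sep _ hY _ _ _ ne _ _ Ux Uy.
    by move=> /(fun H => lt_le_trans H xy); rewrite ltr_nat ltnNge leqnSn.
  exists c, (fun x y => exists i j,
    [/\ c x = i, c y = i, U Y i j x & U Y i j y]).
  split.
  - move=> y x z [i [j [cx cy Ux Uy]]] [k [j' [cy' cz Uy' Uz]]].
    have ik : i = k by rewrite -cy.
    case: _ / ik in j' cy' cz Uy' Uz *.
    exists i, j; split=> //; rewrite (same _ _ _ _ _ Uy Uy')//.
    by rewrite ndxx.
  - move=> x y cxy xy; have [j Ux] := cP x; have [j' Uy] := cP y.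
    exists (c x), j; rewrite -cxy in j' Uy; split=> //.
    by rewrite (same _ _ _ _ _ Ux Uy xy).
  - move=> x y [i [j [_ _ Ux Uy]]]; apply: bnd Ux Uy; split=> //.
    by exists i, j.
exists #|K| => r r0; have [D DP] := YYK (upnat r).
have /(_ _)/cid H (Y : metricType R) : exists U : 'I_#|K|.+1 -> set (set Y),
    YY Y -> [/\ forall x, exists i S, U i S /\ S x,
        forall i S S', U i S -> U i S' -> S <> S' ->
          forall x y, S x -> S' y -> upnat r < nd x y
      & forall i S, U i S -> forall x y, S x -> S y -> nd x y <= D].
  have [hY|nY] := pselect (YY Y); last by exists (fun _ => set0).
  by have [U UP] := colouring_decomposition (DP _ hY); exists U.
exists (fun (Y : metricType R) i => {S : set Y | sval (H Y) i S}).
  exists (fun _ _ j => sval j); split.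
- move=> Y hY; have [cov _ _] := svalP (H Y) hY.
  apply/seteqP; split=> // y _; have [i [S [US Sy]]] := cov y.
  by exists i => //; exists (exist _ S US).
- move=> Y hY i [S US] [S' US'] ne x y /= Sx Sy.
  have SS' : S <> S'.
    move=> SS'; apply: ne; case: _ / SS' in US' Sy *.
    by congr exist.
  have [_ sep _] := svalP (H Y) hY.
  have := sep _ _ _ US US' SS' _ _ Sx Sy.
  rewrite ltnNge ltNge; apply: contra => xy.
  by rewrite nd_le (le_trans xy)// -upnat_le.
- apply/bounded_family_ofP; exists D => Y _ [hY [i [[S US] ->]]] x y /=.
  by have [_ _ bnd] := svalP (H Y) hY; exact: (bnd _ _ US).
Qed.

End FamiliesNat.

(** * Coning off a piece of a metric space *)

Definition rough_isometry (R : realType) (W X : metricType R) (t : nat)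
    (A : set W) (e : W -> X) : Prop :=
  forall x y, A x -> A y ->
    nd (e x) (e y) <= nd x y + t /\ nd x y <= nd (e x) (e y) + t.

Lemma nearest_point (R : realType) (W : metricType R) (A : set W) :
  (exists x, A x) ->
  exists a : W -> W, forall w, A (a w) /\ forall x, A x -> nd w (a w) <= nd w x.
Proof.
move=> [x0 Ax0].
suff H w : exists a, A a /\ forall x, A x -> nd w a <= nd w x.
  by have [a aP] := choice H; exists a.
have exd : exists n, `[< exists x, A x /\ nd w x = n >].
  by exists (nd w x0); apply/asboolP; exists x0.
case: (ex_minnP exd) => m /asboolP[a [Aa <-]] min.
by exists a; split=> // x Ax; apply: min; apply/asboolP; exists x.
Qed.

(** Height is twice the distance to [A], because two neighbouring points at
distance [d] from [A] may have nearest points about [2 * d] apart, and this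
must not exceed their height by more than a constant. The last clause says
that a ball of the horoball centred at a point of [A] stays near [A]: there
[u] moves points by a bounded amount, and [q] is bounded. *)
Lemma cone_off (R : realType) (W X : metricType R) (A : set W) (e : W -> X)
    (t : nat) (q : X -> X -> nat) (K : finType) :
  (exists x, A x) -> rough_isometry t A e -> quasiultrametric q ->
  (forall x y, q x y <= nd x y) -> (forall s, colouring K q s s.+1) ->
  exists (u : W -> X) (h : W -> W -> nat),
    [/\ quasimetric h, forall w w', h w w' <= 2 * nd w w' + t,
        forall r, colouring (bool * K)%type h r (2 * r).+2
      & forall x n, A x ->
          (forall w, h x w <= n -> q (u x) (u w) <= n) /\
          rough_isometry (n + t) [set w | h x w <= n] u].
Proof.
move=> A0 eA qq q_nd qcol; have [a aP] := nearest_point A0.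
pose L w := 2 * nd w (a w).
have Lip w w' : nd w' (a w') <= nd w w' + nd w (a w).
  have [Aa _] := aP w; have [_ /(_ _ Aa) /leq_trans] := aP w'; apply.
  by rewrite (ndC w w'); exact: nd_triangle.
have ea w w' : nd (e (a w)) (e (a w')) <= nd (a w) (a w') + t /\
    nd (a w) (a w') <= nd (e (a w)) (e (a w')) + t.
  by apply: eA; [case: (aP w)|case: (aP w')].
have aa w w' : nd (a w) (a w') <= nd w (a w) + nd w w' + nd w' (a w') /\
    nd w w' <= nd w (a w) + nd (a w) (a w') + nd w' (a w').
  have := nd_triangle w (a w) (a w'); have := nd_triangle w' w (a w').
  have := nd_triangle (a w) w w'; have := nd_triangle (a w') (a w) w'.
  by rewrite (ndC (a w) w) (ndC (a w') w'); lia.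
exists (e \o a), (horo L (e \o a) q); split.
- exact: horo_quasimetric.
- move=> w w'; have := Lip w w'; have := Lip w' w; have := ea w w'.
  have := aa w w'; have := q_nd (e (a w)) (e (a w')).
  by rewrite (ndC w' w) /horo /L /=; lia.
- by move=> r; exact: horo_colouring.
- move=> x n Ax; have Lx : L x = 0.
    have [_ /(_ _ Ax)] := aP x; rewrite ndxx /L; lia.
  have hE w : horo L (e \o a) q x w = maxn (q (e (a x)) (e (a w))) (L w).
    by rewrite /horo Lx /=; lia.
  split=> [w|w w' /=]; rewrite !hE; first by rewrite geq_max => /andP[].
  rewrite !geq_max => /andP[_ Lw] /andP[_ Lw'].
  have := ea w w'; have := aa w w'; move: Lw Lw'; rewrite /L; lia.
Qed.

(** * Regrading the scales *)

(** Renumbering the scales of [Y] by [phi] turns its metric into a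
quasi-ultrametric, any coarse map to it into a contraction, and decompositions
at scale [n] into decompositions with pieces of size [n + 1]. *)
Lemma fast_growth (D rho : nat -> nat) : exists phi : nat -> nat,
  [/\ {homo phi : m n / m <= n}, forall m, phi m + phi m <= phi m.+1,
      forall m, D (phi m) <= phi m.+1, forall m, rho m <= phi m
    & forall m, m <= phi m].
Proof.
pose phi := fix phi m := if m is k.+1
  then k.+1 + rho k.+1 + D (phi k) + (phi k + phi k) else rho 0.
exists phi; split.
- apply: homo_leq => // [x y z|m]; [exact: leq_trans|].
  by rewrite /phi -/phi; lia.
- by move=> m; rewrite /= leq_addl.
- by move=> m; rewrite /=; lia.
- by case=> [|m]; rewrite /phi -/phi; lia.
- by case=> [|m]; rewrite /phi -/phi; lia.
Qed.

Lemma regraded_pullback (R : realType) (X Y : metricType R) (f : X -> Y)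
    (K : finType) (D phi : nat -> nat) :
  {homo phi : m n / m <= n} -> (forall m, phi m + phi m <= phi m.+1) ->
  (forall m, D (phi m) <= phi m.+1) -> (forall m, m <= phi m) ->
  (forall r, colouring K (@nd R Y) r (D r)) ->
  (forall x y, nd (f x) (f y) <= phi (nd x y)) ->
  exists q : X -> X -> nat,
    [/\ forall x y n, (q x y <= n) = (nd (f x) (f y) <= phi n),
        quasiultrametric q, forall x y, q x y <= nd x y
      & forall s, colouring K q s s.+1].
Proof.
move=> phi_le phi2 phiD phi_id col f_le.
exists (fun x y => least (fun n => nd (f x) (f y) <= phi n)).
have qE x y n : (least (fun n => nd (f x) (f y) <= phi n) <= n) =
    (nd (f x) (f y) <= phi n).
  have [||H1 H2] := @least_leP (fun n => nd (f x) (f y) <= phi n) _ _ n.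
  - by exists (nd (f x) (f y)).
  - by move=> m k mk /leq_trans; apply; exact: phi_le.
  - exact/idP/idP.
split=> // [|x y|s].
- split=> [x|x y|y x z].
  + by apply/eqP; rewrite -leqn0 qE ndxx.
  + by under eq_fun do rewrite ndC.
  + set m := maxn _ _; rewrite qE.
    apply: leq_trans (nd_triangle (f y) _ _) _.
    by apply: leq_trans (phi2 m); rewrite leq_add// -qE ?leq_maxl ?leq_maxr.
- by rewrite qE.
- have [c [E [Etr Ecl Ebd]]] := col (phi s).
  exists (c \o f), (fun x y => E (f x) (f y)); split=> [y x z|x y cxy|x y Exy].
  + exact: Etr.
  + by rewrite qE; exact: Ecl.
  + by rewrite qE (leq_trans (Ebd _ _ Exy)).
Qed.

(** * Changing the metric *)

(** A copy of [T] carrying the metric that is [q + 1] off the diagonal. *)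
Definition gauged (T : Type) (q : T -> T -> nat) (qq : quasimetric q) : Type :=
  T.

Section Gauged.
Variables (R : realType) (T : choiceType) (q : T -> T -> nat).
Variable qq : quasimetric q.

HB.instance Definition _ := Choice.copy (gauged qq) T.

Definition gauged_dist (x y : gauged qq) : R :=
  if x == y then 0%R else (q x y).+1%:R%R.

Fact gauged_distxx x : gauged_dist x x = 0%R.
Proof. by rewrite /gauged_dist eqxx. Qed.

Fact gauged_dist_positivity x y : gauged_dist x y = 0%R -> x = y.
Proof. by rewrite /gauged_dist; case: eqP => // _ /eqP; rewrite pnatr_eq0. Qed.

Fact gauged_dist_sym x y : gauged_dist x y = gauged_dist y x.
Proof. by case: qq => _ qC _; rewrite /gauged_dist eq_sym qC. Qed.

Fact gauged_dist_triangle y x z :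
  (gauged_dist x z <= gauged_dist x y + gauged_dist y z)%R.
Proof.
case: qq => _ _ qM; rewrite /gauged_dist.
have [->|xy] := eqVneq x y; first by rewrite add0r.
have [<-|yz] := eqVneq y z; first by rewrite (negPf xy) addr0.
case: eqP => _; first by rewrite addr_ge0.
by rewrite -natrD ler_nat; have := qM y x z; lia.
Qed.

HB.instance Definition _ := isMetric.Build R (gauged qq)
  gauged_distxx gauged_dist_positivity gauged_dist_sym gauged_dist_triangle.

End Gauged.

Lemma nd_gauged (R : realType) (T : choiceType) (q : T -> T -> nat)
    (qq : quasimetric q) (x y : (gauged qq : metricType R)) :
  q x y <= nd x y <= (q x y).+1.
Proof.
have [q0 _ _] := qq; rewrite nd_le.
have [<-|xy] := eqVneq x y; first by rewrite ndxx q0 mdistxx ler0n.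
have -> : mdist x y = (q x y).+1%:R%R.
  by rewrite /mdist /= /gauged_dist (negPf xy).
have : (mdist x y <= (nd x y)%:R)%R by rewrite -nd_le.
by rewrite lexx andbT /mdist /= /gauged_dist (negPf xy) ler_nat; exact: ltnW.
Qed.

(** * Complexity from coarser quasi-metrics *)

Section Complexity.
Variable R : realType.
Implicit Types (a b : ord) (XX YY ZZ : mfamily R).

(** The recursive occurrence in [frakR_step] is nested under an existential
quantifier, where the generated induction principle gives no hypothesis. *)
Lemma frakR_nested_ind (P : ord -> mfamily R -> Prop) :
  (forall a XX, is_ord0 a -> bounded_family XX -> P a XX) ->
  (forall a XX YY (F : fam_fun R), ~ is_ord0 a -> finite_asdim YY ->
    is_family_map F XX YY -> coarse F ->
    (forall BB : subspaces R, is_subfamily BB YY ->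
      bounded_family (family_of BB) ->
      exists b, ord_lt b a /\ P b (family_of (inv_image F BB))) ->
    P a XX) ->
  forall a XX, frakR a XX -> P a XX.
Proof.
move=> P0 PS; fix IH 3 => a XX [{}a {}XX a0 bXX|{}a {}XX YY F a0 dY mF cF H].
  exact: P0.
apply: (PS a XX YY F a0 dY mF cF) => BB sBB bBB.
case: (H BB sBB bBB) => b [ba Hb].
by exists b; split; [exact: ba|exact: IH Hb].
Qed.

(** The identity maps from the members of [ZZ] to their copies with the metric
derived from [q]. *)
Inductive regauging ZZ (q : forall Z : metricType R, Z -> Z -> nat)
    (qq : forall Z, ZZ Z -> quasimetric (@q Z)) : fam_fun R :=
  Regauging (Z : metricType R) (hZ : ZZ Z) :
    @regauging ZZ q qq Z (gauged (qq Z hZ)) (fun z => z).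

(** It suffices to find on each member a coarser quasi-metric, in place of a
coarse map to another family. *)
Lemma frakR_gauge a ZZ (q : forall Z : metricType R, Z -> Z -> nat)
    (rho D : nat -> nat) (K : finType) :
  ~ is_ord0 a ->
  (forall Z, ZZ Z -> [/\ quasimetric (@q Z),
    forall x y : Z, q Z x y <= rho (nd x y)
    & forall r, colouring K (@q Z) r (D r)]) ->
  (forall n, exists b, ord_lt b a /\ forall ZZ',
    (forall Z', ZZ' Z' -> exists (Z : metricType R) (C : set Z),
      [/\ ZZ Z, forall x y, C x -> C y -> q Z x y <= n
        & Z' = subsp C :> metricType R]) ->
    frakR b ZZ') ->
  frakR a ZZ.
Proof.
move=> a0 qP low; have qq Z (hZ : ZZ Z) : quasimetric (@q Z) by case: (qP Z hZ).
pose YY : mfamily R := fun Y => exists Z (hZ : ZZ Z),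
  Y = gauged (qq Z hZ) :> metricType R.
apply: (@frakR_step R a ZZ YY (@regauging ZZ q qq)) => //.
- apply/finite_asdimP; exists K => r; exists (D r).+1 => _ [Z [hZ ->]].
  have [_ _ /(_ r)[c [E [Etr Ecl Ebd]]]] := qP Z hZ.
  exists c, E; split=> // x y.
    move=> cxy xy; apply: Ecl => //; apply: leq_trans xy.
    by have /andP[] := @nd_gauged R Z _ (qq Z hZ) x y.
  move=> /Ebd xy; have /andP[_ H] := @nd_gauged R Z _ (qq Z hZ) x y.
  by apply: leq_trans H _.
- split=> [_ _ _ [Z hZ]|Z hZ]; first by split=> //; exists Z, hZ.
  by exists (gauged (qq Z hZ)), (fun z => z); exact: Regauging.
- apply/coarseP; exists (fun n => (rho n).+1) => _ _ _ [Z hZ] x y.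
  have /andP[_ H] := @nd_gauged R Z _ (qq Z hZ) x y; apply: leq_trans H _.
  by have [_ + _] := qP Z hZ; apply.
move=> BB _ /bounded_family_ofP[n bBB].
have [b [ba Hb]] := low n; exists b; split=> //; apply: Hb.
move=> _ [X [C [[Y [f [B [Ff hB ->]]]] ->]]].
case: Ff B hB => Z hZ B hB; exists Z, B; split=> // x y Bx By.
have /andP[H _] := @nd_gauged R Z _ (qq Z hZ) x y; apply: leq_trans H _.
exact: bBB Bx By.
Qed.

(** * Families with finitely many sheets *)

(** The points of [Z] are represented by configurations of points of [W]; the
first two conditions make the Hausdorff distance of configurations equal to
the distance of [Z]. Only [A], which meets all configurations, is compared
with [X]. *)
Definition sheeted (I : finType) (t : nat) (Z X : metricType R) : Prop :=
  exists (W : metricType R) (s : I -> Z -> W) (A : set W) (e : W -> X),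
    [/\ forall z z' i, exists i', nd (s i z) (s i' z') <= nd z z',
        forall z z' i i', nd z z' <= nd (s i z) (s i' z'),
        forall z, exists i, A (s i z)
      & rough_isometry t A e].

(** In the inductive step [u] is only known to take values in [B] on a part of
its domain, whereas [sheeted] asks for a map defined everywhere. *)
Lemma extend_to_subsp (T : Type) (X : metricType R) (B : set X) (u : T -> X)
    (w0 : T) :
  B (u w0) -> exists e : T -> subsp B, forall w, B (u w) -> \val (e w) = u w.
Proof.
move=> Bw0; have /choice[e eP] w : exists x : subsp B, B (u w) -> \val x = u w.
  have [Bw|nB] := pselect (B (u w)); last by exists (SigSub (mem_set Bw0)).
  by exists (SigSub (mem_set Bw)).
by exists e.
Qed.

(** The control by [X] is asked only of nonempty members because an empty [Z]
may be represented in a nonempty [W] that has no map to the required subset of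
[X]. *)
Lemma frakR_sheeted a XX : frakR a XX ->
  forall (I : finType) (t : nat) ZZ,
    (forall Z : metricType R, ZZ Z -> Z -> exists2 X, XX X & sheeted I t Z X) ->
    frakR a ZZ.
Proof.
elim/frakR_nested_ind: a XX /.
  move=> a XX a0 /bounded_familyP[n nXX] I t ZZ ZX; apply: frakR_bounded => //.
  apply/bounded_familyP; exists (n + t) => Z hZ x y.
  have [X hX [W [s [A [e [_ sZ sA eA]]]]]] := ZX Z hZ x.
  have [i Ai] := sA x; have [i' Ai'] := sA y.
  apply: leq_trans (sZ _ _ i i') _; have [_ /leq_trans->//] := eA _ _ Ai Ai'.
  by rewrite leq_add2r nXX.
move=> a XX YY F a0 /finite_asdimP[K /choice[D colY]] [FXY XF].
move=> /coarseP[rho Frho] IH I t ZZ ZX.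
have [phi [phi_le phi2 phiD phi_rho phi_id]] := fast_growth D rho.
pose BB n : subspaces R := fun Y B => YY Y /\ forall y y', B y -> B y' ->
  nd y y' <= phi n.
pose N := #|{: I * (bool * K)}|.
pose D' r := ((2 * ((2 * N).+1 * r.+1).+1).+2 + N * r.+1).+1.
have /(_ _)/cid qZ (Z : metricType R) : exists q : Z -> Z -> nat, ZZ Z ->
    [/\ quasimetric q, forall x y, q x y <= 2 * nd x y + t,
        forall r, colouring 'I_N.+1 q r (D' r)
      & forall n (C : set Z) (z0 : Z), C z0 ->
          (forall x y, C x -> C y -> q x y <= n) ->
          exists2 X, family_of (inv_image F (BB n.+1)) X &
            sheeted I (n + t) (subsp C) X].
  have [hZ|nZ] := pselect (ZZ Z); last by exists (fun _ _ => 0).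
  (* Nothing is known about an empty [Z], not even a member of [XX]. *)
  have [[z0 _]|Z0] := pselect (exists z : Z, True); last first.
    have Zf (z : Z) : False by apply: Z0; exists z.
    exists (fun _ _ => 0) => _; split=> //.
    by move=> r; exists (fun z => match Zf z with end), (fun _ _ => True).
  have [X hX [W [s [A [e [sn sZ sA eA]]]]]] := ZX Z hZ z0.
  have [Y [f Ff]] := XF X hX; have [_ hY] := FXY _ _ _ Ff.
  have [x y|q [qE qq q_nd qcol]] := regraded_pullback phi_le phi2 phiD phi_id
      (fun r => colY r Y hY) (f := f).
    exact: leq_trans (Frho _ _ _ Ff x y) (phi_rho _).
  have [|u [h [hq h_nd hcol hA]]] := cone_off _ eA qq q_nd qcol.
    by have [i Ai] := sA z0; exists (s i z0).
  exists (haus s h) => _; split.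
  - exact: haus_quasimetric.
  - move=> x y; apply/haus_leP; split=> i.
      have [i' si'] := sn x y i; exists i'; have := h_nd (s i x) (s i' y).
      by lia.
    have [i' si'] := sn y x i; exists i'; have := h_nd (s i y) (s i' x).
    by rewrite (ndC x y); lia.
  - by move=> r; apply: haus_colouring => //; exact: hcol.
  - move=> n C {}z0 Cz0 Cn; have [i0 Ai0] := sA z0.
    have [hq_n hrough] := hA _ n Ai0.
    (* [B] contains the image of every sheet point near [s i0 z0]; doubling its
    radius costs one step of [phi]. *)
    pose B : set Y := [set y | nd (f (u (s i0 z0))) y <= phi n].
    have Bu w : h (s i0 z0) w <= n -> (f @^-1` B) (u w).
      by move=> /hq_n; rewrite qE.
    have [|e' e'P] := @extend_to_subsp _ X (f @^-1` B) u (s i0 z0).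
      by rewrite /B /= ndxx.
    exists (subsp (f @^-1` B)).
      exists X, (f @^-1` B); split=> //; exists Y, f, B; split=> //; split=> //.
      move=> y y'; rewrite /B /= => yn yn'.
      apply: leq_trans (nd_triangle (f (u (s i0 z0))) _ _) _.
      by apply: leq_trans (phi2 n); rewrite leq_add// ndC.
    exists W, (fun i z => s i (\val z)), [set w | h (s i0 z0) w <= n], e'.
    split=> //.
    - by move=> z z' i i'; exact: (sZ (\val z) (\val z') i i').
    - move=> z; have := Cn _ _ Cz0 (set_valP z).
      by move=> /haus_leP[/(_ i0)[i' hi'] _]; exists i'.
    - move=> w w' hw hw'; rewrite nd_subsp !e'P; [exact: hrough|exact: Bu..].
apply: (@frakR_gauge a ZZ (fun Z => sval (qZ Z)) (fun n => 2 * n + t) D'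
  'I_N.+1) => // [Z hZ|n].
  by have [] := svalP (qZ Z) hZ.
have [||b [ba Hb]] := IH (BB n.+1).
- by move=> Y B [].
- by apply/bounded_family_ofP; exists (phi n.+1) => Y B [_]; apply.
exists b; split=> // ZZ' ZZ'P; apply: (Hb I (n + t)) => Z' hZ'.
have [Z [C [hZ Cn ->]]] := ZZ'P _ hZ' => z.
have [_ _ _ low] := svalP (qZ Z) hZ.
exact: low (set_valP z) Cn.
Qed.

(** The configuration of a point of the quotient is its orbit. *)
Lemma quot_sheeted (gT : finGroupType) (X : metricType R)
    (to : isom_action gT X) : sheeted gT 0 (quot to) X.
Proof.
have dE (z z' : quot to) : mdist z z' = orbit_dist to (repr z) (repr z') by [].
exists X, (fun g z => to g (repr z)), setT, id; split.
- move=> z z' g; rewrite /nd dE.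
  have [h ->] := orbit_dist_attained to (repr z) (repr z').
  by exists (g * h)%g; rewrite isom_actM isom_act_isom.
- move=> z z' g g'; rewrite nd_le dE.
  apply: le_trans (orbit_dist_le _ _ _ (g^-1 * g')%g) _.
  by rewrite -(isom_act_isom to g) -isom_actM mulKVg -nd_le.
- by move=> z; exists 1%g.
- by move=> x y _ _; rewrite !addn0.
Qed.

End Complexity.

Theorem theorem5p28 (R : realType) :
  (forall a : ord, finite_quotient_permanence (@frakR R a)) /\
  finite_quotient_permanence (@regular_fdc R).
Proof.
have quotP (a : ord) : finite_quotient_permanence (@frakR R a).
  move=> XX RXX gT to; apply: (frakR_sheeted RXX (I := gT) (t := 0)).
  by move=> _ [X [hX ->]] _; exists X => //; exact: quot_sheeted.
split=> // XX [a [ca RXX]] gT to; exists a; split=> //; exact: quotP.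
Qed.
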